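(* Let $\overline{\Phi}\subseteq\Phi$ be a rank $2$ root subsystem with dihedral reflection group $\overline W\subseteq W$, and let $w\in W$, written uniquely as $w=\lfloor w\rfloor\,\overline w$ with $\overline w\in\overline W$, where $\lfloor w\rfloor$ is the minimal element of the coset $w\overline W$. Under the bijection $\overline W\to w\overline W$, $\overline v\mapsto\lfloor w\rfloor\overline v$, every edge of the graph on $w\overline W$ induced from $\mathrm{QB}(W)$ corresponds to an edge of $\mathrm{QB}(\overline W)$. In other words, if $w\xrightarrow{\alpha}ws_\alpha$ is an edge of $\mathrm{QB}(W)$ with $\alpha\in\overline{\Phi}^+$, then $\overline w\xrightarrow{\alpha}\overline w s_\alpha$ is an edge of $\mathrm{QB}(\overline W)$.
   Context: $\Phi$ is an irreducible (finite, crystallographic) root system with positive roots $\Phi^+$, simple roots, Weyl group $W$ and length function $\ell$; for $\alpha\in\Phi$, $\alpha^\vee=2\alpha/\langle\alpha,\alpha\rangle$ and $\mathrm{ht}(\alpha^\vee)$ is the sum of the coefficients of $\alpha^\vee$ in the basis of simple coroots. The quantum Bruhat graph $\mathrm{QB}(W)$ is the directed graph on $W$ with an edge $v\xrightarrow{\alpha}vs_\alpha$ ($\alpha\in\Phi^+$) whenever $\ell(vs_\alpha)=\ell(v)+1$ or $\ell(vs_\alpha)=\ell(v)-2\mathrm{ht}(\alpha^\vee)+1$. A rank 2 root subsystem is a subset $\overline\Phi\subseteq\Phi$ which is itself a root system of rank 2; $\overline\Phi^+:=\overline\Phi\cap\Phi^+$ with its own simple roots, $\overline W$ is the group generated by $s_\alpha$,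 $\alpha\in\overline\Phi$, viewed as a dihedral reflection group with its own length function $\overline\ell$ (w.r.t. the simple reflections of $\overline\Phi$) and coroot heights computed in $\overline\Phi^\vee$; $\mathrm{QB}(\overline W)$ is defined by the same rule using $\overline\Phi^+$, $\overline\ell$ and these heights. On a coset $w\overline W$ consider the partial order generated by the relations $v<vs_\alpha$ for $v\in w\overline W$, $\alpha\in\overline\Phi$, $\ell(vs_\alpha)>\ell(v)$; by a result of Brenti–Fomin–Postnikov this order has a unique minimal element $\lfloor w\rfloor$, and $\overline v\mapsto\lfloor w\rfloor\overline v$ is an isomorphism of posets from $\overline W$ (Bruhat order) to $w\overline W$. *)

(* Defs.v *)
(* Root systems are realised concretely as finite lists of
   column vectors in R^n (R an arbitrary real field, standard inner product);
   Weyl group elements are n x n matrices acting on column vectors. *)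
From HB Require Import structures.
From mathcomp Require Import all_boot all_order all_algebra.
From Stdlib Require Import ClassicalEpsilon Relation_Operators.
Set Implicit Arguments. Unset Strict Implicit. Unset Printing Implicit Defensive.
Import Order.TTheory GRing.Theory Num.Theory.
Local Open Scope ring_scope.

Section RootSystems.
Context {R : realFieldType} {n : nat}.
Notation vec := 'cV[R]_n.
Notation mat := 'M[R]_n.

Definition dot (x y : vec) : R := \sum_(i < n) x i 0 * y i 0.

Definition refl (a : vec) : mat := 1%:M - (2 / dot a a) *: (a *m a^T).

Definition coroot (a : vec) : vec := (2 / dot a a) *: a.

Definition wprod (s : seq vec) : mat := foldr (fun a M => refl a *m M) 1%:M s.

Definition is_root_system (Psi : seq vec) : Prop :=
  [/\ 0 \notin Psi,
      forall a b, a \in Psi -> b \in Psi -> refl a *m b \in Psi,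
      forall a b, a \in Psi -> b \in Psi ->
        exists z : int, 2 * dot b a / dot a a = z%:~R
    & forall a (c : R), a \in Psi -> c *: a \in Psi -> c = 1 \/ c = -1].

Definition spans (Psi : seq vec) : Prop :=
  forall x : vec, exists c : 'I_(size Psi) -> R,
    x = \sum_(i < size Psi) c i *: nth 0 Psi i.

Definition irreducible (Psi : seq vec) : Prop :=
  forall P : pred vec,
    (forall a b, a \in Psi -> b \in Psi -> P a -> ~~ P b -> dot a b = 0) ->
    (forall a, a \in Psi -> P a) \/ (forall a, a \in Psi -> ~~ P a).

Definition rank_rs (Psi : seq vec) : nat :=
  \rank (\matrix_(i < size Psi) (nth 0 Psi i)^T).

Definition is_base (Psi D : seq vec) : Prop :=
  [/\ uniq D, {subset D <= Psi},
      forall c : 'I_(size D) -> R,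
        \sum_(i < size D) c i *: nth 0 D i = 0 -> forall i, c i = 0
    & forall b, b \in Psi -> exists k : 'I_(size D) -> int,
        b = \sum_(i < size D) (k i)%:~R *: nth 0 D i /\
        ((forall i, 0 <= k i) \/ (forall i, k i <= 0))].

Definition pos (D : seq vec) (b : vec) : Prop :=
  exists k : 'I_(size D) -> R, (forall i, 0 <= k i) /\
    b = \sum_(i < size D) k i *: nth 0 D i.

Definition coroot_ht (D : seq vec) (a : vec) (h : R) : Prop :=
  exists c : 'I_(size D) -> R,
    coroot a = \sum_(i < size D) c i *: coroot (nth 0 D i) /\
    h = \sum_(i < size D) c i.

Definition in_W (Psi : seq vec) (w : mat) : Prop :=
  exists s : seq vec, {subset s <= Psi} /\ w = wprod s.

Definition has_word (D : seq vec) (k : nat) (w : mat) : bool :=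
  [exists t : k.-tuple 'I_(size D), w == wprod [seq nth 0 D (nat_of_ord i) | i <- (t : seq _)]].

Definition ell (D : seq vec) (w : mat) : nat :=
  match excluded_middle_informative (exists k, has_word D k w) with
  | left h => ex_minn h
  | right _ => 0%N
  end.

Definition QB_edge (Psi D : seq vec) (v : mat) (a : vec) : Prop :=
  [/\ in_W Psi v, a \in Psi, pos D a &
      (ell D (v *m refl a) = (ell D v).+1) \/
      (exists h, coroot_ht D a h /\
         (ell D (v *m refl a))%:R = (ell D v)%:R - 2 * h + 1)].

Definition in_coset (Psib : seq vec) (w v : mat) : Prop :=
  exists x, in_W Psib x /\ v = w *m x.

Definition coset_step (Psib D : seq vec) (w v v' : mat) : Prop :=
  in_coset Psib w v /\
  exists a, a \in Psib /\ v' = v *m refl a /\ (ell D v < ell D v')%N.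

Definition coset_lt (Psib D : seq vec) (w : mat) : mat -> mat -> Prop :=
  clos_trans mat (coset_step Psib D w).

Definition coset_minimal (Psib D : seq vec) (w u : mat) : Prop :=
  in_coset Psib w u /\ ~ (exists v, in_coset Psib w v /\ coset_lt Psib D w v u).

End RootSystems.

(* Main.v *)
(* Write N(a) for the set of positive roots sent to negative ones by s_a, and
   sgn for the sign of a root. Counting inversions gives, for a > 0,
     l(w s_a) - l(w) = sum_(b in N(a)) sgn(w b)   and
     sum_(b in N(a)) <b, a^v> = 2 ht(a^v),
   the second because <2 rho, d^v> = 2 for every simple root d. The involution
   b |-> b' = - s_a b of N(a) satisfies b + b' = <b, a^v> a with <b, a^v> >= 1,
   so at least one of w b, w b' has the sign of w a.
   Hence w -> w s_a is an edge iff a certain function f on N(a) with f >= 0 and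
   f(a) >= 1 has total sum 1: for an edge of the Bruhat order
   f(b) = (sgn(w b) + sgn(w b')) / 2, for a quantum edge
   f(b) = <b, a^v> + sgn(w b). Such a sum stays equal to 1 on any subset of N(a)
   containing a, in particular on the analogue of N(a) for the subsystem.
   Minimality of the coset representative u means that u preserves positivity on
   the subsystem, so sgn(w b) = sgn(wb b) there. *)
Require Import Defs.
From HB Require Import structures.
From mathcomp Require Import all_boot all_order all_algebra.
From mathcomp Require Import ring lra.
From Stdlib Require Import ClassicalEpsilon Relation_Operators.
Set Implicit Arguments. Unset Strict Implicit. Unset Printing Implicit Defensive.
Import Order.TTheory GRing.Theory Num.Theory.
Local Open Scope ring_scope.

(** * Reflections *)

Section Reflections.
Context {R : realFieldType} {n : nat}.
Implicit Types (x y a b d : 'cV[R]_n) (M : 'M[R]_n).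

Lemma dotE x y : dot x y = (y^T *m x) 0 0.
Proof. by rewrite mxE; apply: eq_bigr => i _; rewrite mxE mulrC. Qed.

Lemma dotC x y : dot x y = dot y x.
Proof. by apply: eq_bigr => i _; rewrite mulrC. Qed.

Lemma dotDl x y z : dot (x + y) z = dot x z + dot y z.
Proof. by rewrite !dotE mulmxDr mxE. Qed.

Lemma dotNl x z : dot (- x) z = - dot x z.
Proof. by rewrite !dotE mulmxN mxE. Qed.

Lemma dotZl c x z : dot (c *: x) z = c * dot x z.
Proof. by rewrite !dotE -scalemxAr mxE. Qed.

Lemma dotZr c x z : dot x (c *: z) = c * dot x z.
Proof. by rewrite dotC dotZl dotC. Qed.

Lemma dotDr x y z : dot x (y + z) = dot x y + dot x z.
Proof. by rewrite dotC dotDl !(dotC x). Qed.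

Lemma dotNr x z : dot x (- z) = - dot x z.
Proof. by rewrite dotC dotNl dotC. Qed.

Lemma dot0l x : dot 0 x = 0.
Proof. by rewrite dotE mulmx0 mxE. Qed.

Lemma dot_sumr (I : Type) (s : seq I) (P : pred I) (F : I -> 'cV[R]_n) x :
  dot x (\sum_(i <- s | P i) F i) = \sum_(i <- s | P i) dot x (F i).
Proof.
elim/big_rec2: _ => [|i y1 y2 _ <-]; first by rewrite dotC dot0l.
by rewrite dotDr.
Qed.

Lemma dot_gt0 x : x != 0 -> 0 < dot x x.
Proof.
move=> x0; rewrite lt_neqAle eq_sym; apply/andP; split; last first.
  by apply: sumr_ge0 => i _; rewrite -expr2 sqr_ge0.
apply: contra x0 => /eqP dxx; apply/eqP/matrixP => i j; rewrite ord1 mxE.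
have /psumr_eq0P := dxx; move=> /(_ (fun i _ => sqr_ge0 (x i 0))) /(_ i isT).
by move=> /eqP; rewrite mulf_eq0 orbb => /eqP.
Qed.

Lemma reflE a b : refl a *m b = b - (2 * dot b a / dot a a) *: a.
Proof.
rewrite /refl mulmxBl mul1mx -scalemxAl -mulmxA.
suff -> : a *m (a^T *m b) = dot b a *: a by rewrite scalerA mulrAC.
by rewrite [a^T *m b]mx11_scalar -dotE mul_mx_scalar.
Qed.

Lemma mulmx_ext M N : (forall x, M *m x = N *m x) -> M = N.
Proof.
move=> MN; apply/matrixP => i j; have := MN (delta_mx j 0).
by move=> /matrixP /(_ i 0); rewrite -!colE !mxE.
Qed.

Lemma reflK a : a != 0 -> refl a *m refl a = 1%:M.
Proof.
move=> /dot_gt0 /lt0r_neq0 a0; apply: mulmx_ext => x.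
rewrite -mulmxA mul1mx [refl a *m x]reflE reflE dotDl dotNl dotZl divfK //.
rewrite -addrA -opprD -scalerDl.
by rewrite (_ : 2 * _ / _ + _ = 0) ?scale0r ?subr0 //; field.
Qed.

Lemma refl_self a : a != 0 -> refl a *m a = - a.
Proof.
move=> /dot_gt0 /lt0r_neq0 a0; rewrite reflE mulfK //.
by rewrite scaler_nat mulr2n opprD addrA subrr sub0r.
Qed.

Lemma reflN a : refl (- a) = refl a.
Proof. by rewrite /refl dotNl dotNr opprK raddfN /= mulNmx mulmxN opprK. Qed.

Definition isometry M := forall x y, dot (M *m x) (M *m y) = dot x y.

Lemma isometry_refl a : a != 0 -> isometry (refl a).
Proof.
move=> /dot_gt0 /lt0r_neq0 a0 x y; rewrite !reflE.
by rewrite !(dotDl, dotDr, dotNl, dotNr, dotZl, dotZr) (dotC a y); field.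
Qed.

Lemma isometryM M N : isometry M -> isometry N -> isometry (M *m N).
Proof. by move=> HM HN x y; rewrite -!mulmxA HM HN. Qed.

Lemma isometry_inj M : isometry M -> injective (mulmx M : 'cV_n -> 'cV_n).
Proof.
move=> HM x y Mxy; apply/eqP; rewrite -subr_eq0; apply/negPn/negP => /dot_gt0.
by rewrite -HM mulmxBr Mxy subrr dot0l ltxx.
Qed.

(** The conjugation rule M s_a M^-1 = s_(M a), stated without inverses. *)
Lemma isometry_reflC M a : isometry M -> M *m refl a = refl (M *m a) *m M.
Proof.
move=> HM; apply: mulmx_ext => x.
by rewrite -!mulmxA !reflE mulmxBr -scalemxAr !HM.
Qed.

Lemma wprod_cat (s t : seq 'cV[R]_n) : wprod (s ++ t) = wprod s *m wprod t.
Proof. by elim: s => [|a s IH] /=; rewrite ?mul1mx // IH mulmxA. Qed.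

Lemma wprod_rcons s a : wprod (rcons s a) = wprod s *m refl a.
Proof. by rewrite -cats1 wprod_cat /= mulmx1. Qed.

Definition coroot_pair b a : R := dot b (coroot a).

Lemma coroot_pairE b a : coroot_pair b a = 2 * dot b a / dot a a.
Proof. by rewrite /coroot_pair /coroot dotZr mulrAC. Qed.

End Reflections.

Lemma ler_sum_sub (R : realFieldType) (T : eqType) (s s' : seq T) (P P' : pred T)
    (F : T -> R) :
    uniq s -> uniq s' ->
    {in s, forall b, P b -> (b \in s') && P' b} ->
    {in s', forall b, P' b -> 0 <= F b} ->
  \sum_(b <- s | P b) F b <= \sum_(b <- s' | P' b) F b.
Proof.
move=> us us' ss' F0.
have -> : \sum_(b <- s | P b) F b = \sum_(b <- s' | (b \in s) && P b) F b.
  rewrite -big_filter -[RHS]big_filter; apply: perm_big.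
  apply: uniq_perm; rewrite ?filter_uniq // => b; rewrite !mem_filter.
  rewrite andbC; case bs: (b \in s) => //=; case Pb: (P b) => //=.
  by have /andP[->] := ss' b bs Pb.
rewrite big_mkcond [leRHS]big_mkcond !big_seq; apply: ler_sum => b bs'.
case: ifP => [/andP[bs Pb]|_]; last by case: ifP => // /F0 ->.
by have /andP[_ ->] := ss' b bs Pb.
Qed.

(** * Positive roots *)

Section BasedRootSystem.
Context {R : realFieldType} {n : nat}.
Context (Psi D : seq 'cV[R]_n).
Context (rsPsi : is_root_system Psi) (baseD : is_base Psi D).
Implicit Types (x y a b d : 'cV[R]_n) (w v : 'M[R]_n).

Let ref_mem a b : a \in Psi -> b \in Psi -> refl a *m b \in Psi.
Proof. by case: rsPsi => _ H _ _; apply: H. Qed.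

Lemma root_neq0 b : b \in Psi -> b != 0.
Proof. by case: rsPsi => H _ _ _; apply: contraTneq => ->. Qed.

Lemma root_opp b : b \in Psi -> - b \in Psi.
Proof. by move=> bP; rewrite -refl_self ?root_neq0 // ref_mem. Qed.

Let D_sub d : d \in D -> d \in Psi.
Proof. by case: baseD => _ H _ _; apply: H. Qed.

Lemma wprod_root s b : {subset s <= Psi} -> b \in Psi -> wprod s *m b \in Psi.
Proof.
move=> + bP; elim: s => [|a s IH] sP /=; first by rewrite mul1mx.
rewrite -mulmxA; apply: ref_mem; first exact/sP/mem_head.
by apply: IH => x xs; rewrite sP // inE xs orbT.
Qed.

Lemma wprod_isometry s : {subset s <= Psi} -> isometry (wprod s).
Proof.
elim: s => [|a s IH] sP /=; first by move=> x y; rewrite !mul1mx.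
apply: isometryM; first by apply/isometry_refl/root_neq0/sP/mem_head.
by apply: IH => x xs; rewrite sP // inE xs orbT.
Qed.

Lemma in_W_root w b : in_W Psi w -> b \in Psi -> w *m b \in Psi.
Proof. by case=> s [sP ->]; apply: wprod_root. Qed.

Lemma in_W_isometry w : in_W Psi w -> isometry w.
Proof. by case=> s [sP ->]; apply: wprod_isometry. Qed.

Lemma in_WM w v : in_W Psi w -> in_W Psi v -> in_W Psi (w *m v).
Proof.
case=> s [sP ->] [t [tP ->]]; exists (s ++ t); rewrite wprod_cat; split=> // x.
by rewrite mem_cat => /orP[/sP|/tP].
Qed.

Lemma in_W_refl a : a \in Psi -> in_W Psi (refl a).
Proof.
by move=> aP; exists [:: a]; rewrite /= mulmx1; split=> // x; rewrite inE => /eqP->.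
Qed.

(** Excluded middle turns positivity into a boolean, so that it can index sums and be counted. *)
Definition posb b : bool := if excluded_middle_informative (pos D b) then true else false.

Lemma posbP b : reflect (pos D b) (posb b).
Proof. by rewrite /posb; case: excluded_middle_informative => H; constructor. Qed.

Lemma posD x y : posb x -> posb y -> posb (x + y).
Proof.
move=> /posbP[k [k0 ->]] /posbP[l [l0 ->]]; apply/posbP.
exists (fun i => k i + l i); split=> [i|]; first by rewrite addr_ge0.
by rewrite -big_split; apply: eq_bigr => i _; rewrite scalerDl.
Qed.

Lemma posZ c x : 0 <= c -> posb x -> posb (c *: x).
Proof.
move=> c0 /posbP[k [k0 ->]]; apply/posbP.
exists (fun i => c * k i); split=> [i|]; first by rewrite mulr_ge0.
by rewrite scaler_sumr; apply: eq_bigr => i _; rewrite scalerA.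
Qed.

Lemma base_inj (k l : 'I_(size D) -> R) :
  \sum_i k i *: nth 0 D i = \sum_i l i *: nth 0 D i -> k =1 l.
Proof.
move=> kl i; apply/eqP; rewrite -subr_eq0; apply/eqP.
case: baseD => _ _ /(_ (fun i => k i - l i)) H _; apply: H.
under eq_bigr do rewrite scalerBl.
by rewrite sumrB kl subrr.
Qed.

(** The base coordinates of a root share one sign; by linear independence only 0 could have both
    signs. *)
Lemma pos_opp b : b \in Psi -> posb (- b) = ~~ posb b.
Proof.
move=> bP; apply/idP/idP => [/posbP[k [k0 kE]]|].
  apply/negP => /posbP[l [l0 lE]].
  have E : forall i, l i = - k i.
    apply: base_inj; rewrite -lE -[LHS]opprK kE -sumrN.
    by apply: eq_bigr => i _; rewrite scaleNr.
  have l00 i : l i = 0.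
    by apply/eqP; rewrite eq_le l0 E oppr_le0 k0.
  move/negP: (root_neq0 bP); apply; apply/eqP; rewrite lE big1 // => i _.
  by rewrite l00 scale0r.
case: baseD => _ _ _ /(_ _ bP)[k [kE [k0|k0]]].
  move=> /posbP[]; exists (fun i => (k i)%:~R); split=> // i.
  by rewrite ler0z.
move=> _; apply/posbP; exists (fun i => - (k i)%:~R); split=> [i|].
  by rewrite oppr_ge0 lerz0.
by rewrite kE -sumrN; apply: eq_bigr => i _; rewrite scaleNr.
Qed.

Lemma pos_base d : d \in D -> posb d.
Proof.
move=> dD; apply/posbP; have idx : (index d D < size D)%N by rewrite index_mem.
exists (fun i => (i == Ordinal idx)%:R); split=> [i|]; first by rewrite ler0n.
rewrite (bigD1 (Ordinal idx)) //= eqxx scale1r nth_index // big1 ?addr0 // => i.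
by move=> /negPf->; rewrite scale0r.
Qed.

Lemma pos_int_coord b : b \in Psi -> posb b ->
  exists k : 'I_(size D) -> int,
    b = \sum_i (k i)%:~R *: nth 0 D i /\ forall i, 0 <= k i.
Proof.
move=> bP bpos; case: baseD => _ _ _ /(_ _ bP)[k [kE [k0|k0]]].
  by exists k.
suff : posb (- b) by rewrite pos_opp // bpos.
apply/posbP; exists (fun i => - (k i)%:~R); split=> [i|].
  by rewrite oppr_ge0 lerz0.
by rewrite kE -sumrN; apply: eq_bigr => i _; rewrite scaleNr.
Qed.

Lemma base_nthE d : d \in D -> {i : 'I_(size D) | d = nth 0 D i}.
Proof.
move=> dD; have idx : (index d D < size D)%N by rewrite index_mem.
by exists (Ordinal idx); rewrite /= nth_index.
Qed.

Lemma addZ_nthE (k : 'I_(size D) -> R) c (i : 'I_(size D)) :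
  \sum_j k j *: nth 0 D j + c *: nth 0 D i =
  \sum_j (k j + c * (j == i)%:R) *: nth 0 D j.
Proof.
rewrite (bigD1 i) //= [RHS](bigD1 i) //= eqxx mulr1 scalerDl addrAC.
congr (_ + _); apply: eq_bigr => j /negPf->.
by rewrite mulr0 addr0.
Qed.

(** [refl d] changes only the coordinate at d. If the image is negative, all other coordinates of b
    vanish, so b is a multiple of d, hence d itself. *)
Lemma simple_refl_pos d b : d \in D -> b \in Psi -> posb b -> b != d ->
  posb (refl d *m b).
Proof.
move=> dD bP bpos; apply: contraNT => npos.
have sP : refl d *m b \in Psi by rewrite ref_mem // D_sub.
have /posbP[l [l0 lE]] : posb (- (refl d *m b)) by rewrite pos_opp.
have [k [kE k0]] := pos_int_coord bP bpos.
have [i di] := base_nthE dD.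
have kl j : - l j = (k j)%:~R + (- (2 * dot b d / dot d d)) * (j == i)%:R.
  move: j; apply: base_inj; rewrite -addZ_nthE -kE -di scaleNr -reflE.
  rewrite -[RHS]opprK lE -sumrN; apply: eq_bigr => j _; by rewrite scaleNr.
have k00 j : j != i -> k j = 0.
  move=> /negPf ji; have := kl j; rewrite ji mulr0 addr0 => E.
  apply/eqP; rewrite eq_le k0 andbT -(lerz0 R) -E oppr_le0; exact: l0.
have bE : b = (k i)%:~R *: d.
  rewrite {1}kE (bigD1 i) //= -di big1 ?addr0 // => j ji.
  by rewrite k00 // scale0r.
case: rsPsi => _ _ _ /(_ d (k i)%:~R (D_sub dD)); rewrite -bE => /(_ bP)[E|E].
  by rewrite bE E scale1r.
have := k0 i; rewrite -(ler0z R) E => /le_lt_trans /(_ (ltrN10 R)).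
by rewrite ltxx.
Qed.


(** * Sums over the inversions of a reflection *)

(** The set N(a), as a predicate on all vectors; sums over it run through [undup Psi]. *)
Definition refl_inv a : pred 'cV[R]_n := fun b => posb b && ~~ posb (refl a *m b).

Lemma sum_roots_reindex (h : 'cV[R]_n -> 'cV[R]_n) (P : pred 'cV[R]_n)
    (F : 'cV[R]_n -> R) :
    {in Psi, forall b, h b \in Psi} -> {in Psi &, injective h} ->
  \sum_(b <- undup Psi | P (h b)) F (h b) = \sum_(b <- undup Psi | P b) F b.
Proof.
move=> hP hI; rewrite -(big_map h P F); apply: perm_big.
have hU : uniq (map h (undup Psi)).
  rewrite map_inj_in_uniq ?undup_uniq // => x y.
  by rewrite !mem_undup; apply: hI.
apply: uniq_perm; rewrite ?undup_uniq //.
have [] // := uniq_min_size hU _ (_ : size (undup Psi) <= _)%N.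
  by move=> x /mapP[y]; rewrite !mem_undup => yP ->; apply: hP.
by rewrite size_map.
Qed.

(** Reindexing by s_a makes the second sum run over the b with s_a b > 0. Roots counted in both sums
    cancel; N(a) and -N(a) remain and contribute equally by oddness. *)
Lemma sum_refl_odd (F : 'cV[R]_n -> R) a : a \in Psi ->
    {in Psi, forall b, F (- b) = - F b} ->
  \sum_(b <- undup Psi | posb b) F b - \sum_(b <- undup Psi | posb b) F (refl a *m b)
  = 2 * \sum_(b <- undup Psi | refl_inv a b) F b.
Proof.
move=> aP oddF; have aK x : refl a *m (refl a *m x) = x.
  by rewrite mulmxA reflK ?mul1mx ?root_neq0.
have -> : \sum_(b <- undup Psi | posb b) F (refl a *m b)
    = \sum_(b <- undup Psi | posb (refl a *m b)) F b.
  rewrite -(@sum_roots_reindex (mulmx (refl a)) (fun b => posb (refl a *m b))).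
  - by apply: eq_bigl => b; rewrite aK.
  - by move=> b; apply: ref_mem.
  - by move=> x y _ _ /isometry_inj; apply; apply/isometry_refl/root_neq0.
rewrite (bigID (fun b => posb (refl a *m b))) /=.
rewrite [X in _ - X](bigID posb) /= (eq_bigl _ _ (fun b => andbC (posb b) _)).
have -> : \sum_(b <- undup Psi | posb (refl a *m b) && ~~ posb b) F b
    = - \sum_(b <- undup Psi | refl_inv a b) F b.
  rewrite -sumrN -(@sum_roots_reindex -%R).
  - rewrite [LHS]big_seq_cond [RHS]big_seq_cond; apply: eq_big => b.
      rewrite mem_undup; case bP: (b \in Psi) => //=.
      by rewrite mulmxN !pos_opp ?ref_mem // /refl_inv negbK andbC.
    by rewrite mem_undup => /andP[bP _]; rewrite oddF.
  - by move=> b; apply: root_opp.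
  - by move=> x y _ _ /oppr_inj.
rewrite /refl_inv; ring.
Qed.

Definition sgn b : R := if posb b then 1 else -1.

Lemma sgn_opp b : b \in Psi -> sgn (- b) = - sgn b.
Proof. by move=> bP; rewrite /sgn pos_opp //; case: posb; rewrite //= opprK. Qed.

(* [undup] because the list of roots may contain repetitions. *)
Definition inv w : nat := count (fun b => posb b && ~~ posb (w *m b)) (undup Psi).

(** For each positive b, 1 - sgn(w b) is twice the indicator of an inversion. *)
Lemma invE w : 2 * (inv w)%:R =
  \sum_(b <- undup Psi | posb b) 1 - \sum_(b <- undup Psi | posb b) sgn (w *m b).
Proof.
rewrite /inv -sum1_count natr_sum -sumrB big_mkcondr mulr_sumr /=.
by apply: eq_bigr => b _; rewrite /sgn; case: posb => /=; lra.
Qed.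

Lemma inv_mul_refl w a : in_W Psi w -> a \in Psi ->
  (inv (w *m refl a))%:R =
  (inv w)%:R + \sum_(b <- undup Psi | refl_inv a b) sgn (w *m b).
Proof.
move=> wW aP.
have E : \sum_(b <- undup Psi | posb b) sgn (w *m refl a *m b)
    = \sum_(b <- undup Psi | posb b) sgn (w *m (refl a *m b)).
  by apply: eq_bigr => b _; rewrite mulmxA.
have := invE w; have := invE (w *m refl a); rewrite E.
have oddF : {in Psi, forall b, sgn (w *m - b) = - sgn (w *m b)}.
  by move=> b bP; rewrite mulmxN sgn_opp ?in_W_root.
have /= := @sum_refl_odd (fun b => sgn (w *m b)) a aP oddF.
lra.
Qed.

(** For simple d the set N(d) is {d}. *)
Lemma refl_inv_simple (F : 'cV[R]_n -> R) d : d \in D ->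
  \sum_(b <- undup Psi | refl_inv d b) F b = F d.
Proof.
move=> dD; have dP := D_sub dD; rewrite big_mkcond.
rewrite (bigD1_seq d) ?mem_undup ?undup_uniq //= [X in _ + X]big_seq_cond.
rewrite [X in _ + X]big1 => [|b].
  rewrite addr0 /refl_inv refl_self ?root_neq0 // pos_opp // negbK.
  by rewrite pos_base.
rewrite mem_undup => /andP[bP bd]; case: ifP => // /andP[bpos].
by rewrite simple_refl_pos.
Qed.

Lemma inv_mul_simple w d : in_W Psi w -> d \in D ->
  (inv (w *m refl d))%:R = (inv w)%:R + sgn (w *m d).
Proof.
move=> wW dD; rewrite inv_mul_refl ?D_sub //.
by rewrite (refl_inv_simple (fun b => sgn (w *m b))).
Qed.

(** The pairing with a^v is odd and s_a negates it, so the difference in [sum_refl_odd] is twice the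
    sum over the positive roots. *)
Lemma sum_coroot_pair a : a \in Psi ->
  \sum_(b <- undup Psi | refl_inv a b) coroot_pair b a
  = \sum_(b <- undup Psi | posb b) coroot_pair b a.
Proof.
move=> aP; have oddF : {in Psi, forall b, coroot_pair (- b) a = - coroot_pair b a}.
  by move=> b _; rewrite /coroot_pair dotNl.
have /= := @sum_refl_odd (coroot_pair^~ a) a aP oddF.
have -> : \sum_(b <- undup Psi | posb b) coroot_pair (refl a *m b) a
    = - \sum_(b <- undup Psi | posb b) coroot_pair b a.
  rewrite -sumrN; apply: eq_bigr => b _.
  have a0 := lt0r_neq0 (dot_gt0 (root_neq0 aP)).
  rewrite !coroot_pairE reflE dotDl dotNl dotZl; by field.
lra.
Qed.

Lemma sum_pair_simple d : d \in D ->
  \sum_(b <- undup Psi | posb b) coroot_pair b d = 2.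
Proof.
move=> dD; have dP := D_sub dD; rewrite -sum_coroot_pair //.
rewrite (refl_inv_simple (coroot_pair^~ d)) // coroot_pairE mulfK //.
exact/lt0r_neq0/dot_gt0/root_neq0.
Qed.

(** The sum over positive roots is <2 rho, a^v>; expanding a^v in simple coroots, each of them
    contributes 2 times its coefficient. *)
Lemma sum_pair_height a h : a \in Psi -> coroot_ht D a h ->
  \sum_(b <- undup Psi | refl_inv a b) coroot_pair b a = 2 * h.
Proof.
move=> aP [c [cE ->]]; rewrite sum_coroot_pair // /coroot_pair cE.
under eq_bigr do rewrite dot_sumr.
rewrite exchange_big mulr_sumr /=; apply: eq_bigr => i _.
under eq_bigr do rewrite dotZr.
rewrite -mulr_sumr sum_pair_simple ?mem_nth // mulrC //.
Qed.

Lemma coroot_ht_ex a : a \in Psi -> exists h, coroot_ht D a h.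
Proof.
move=> aP; case: baseD => _ _ _ /(_ _ aP)[k [kE _]].
(* If a = sum k_i d_i, then a^v = sum k_i (<d_i, d_i> / <a, a>) d_i^v. *)
pose c i : R := 2 / dot a a * (k i)%:~R * (dot (nth 0 D i) (nth 0 D i) / 2).
exists (\sum_i c i), c; split=> //.
rewrite /coroot [X in _ *: X]kE scaler_sumr; apply: eq_bigr => i _.
have d0 : dot (nth 0 D i) (nth 0 D i) != 0.
  by apply/lt0r_neq0/dot_gt0/root_neq0/D_sub/mem_nth.
have a0 := lt0r_neq0 (dot_gt0 (root_neq0 aP)).
by rewrite !scalerA; congr (_ *: _); rewrite /c; field; rewrite a0 d0.
Qed.

(** If the integer <b, a^v> were at most 0, s_a b = b - <b, a^v> a would be a nonnegative
    combination of positive roots. *)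
Lemma refl_inv_pair_ge1 a b : a \in Psi -> b \in Psi -> posb a ->
  refl_inv a b -> 1 <= coroot_pair b a.
Proof.
move=> aP bP apos /andP[bpos]; apply: contraNT.
have [z zE] : exists z : int, coroot_pair b a = z%:~R.
  by rewrite coroot_pairE; case: rsPsi => _ _ H _; apply: H.
rewrite reflE -coroot_pairE zE -ltNge ltrz1 => z0.
by rewrite -scaleNr posD // posZ // oppr_ge0 lerz0 -ltzD1 add0r.
Qed.

(** * The involution b |-> - s_a b on the inversions of s_a *)

Lemma refl_inv_opp a b : a \in Psi -> b \in Psi ->
  refl_inv a (- (refl a *m b)) = refl_inv a b.
Proof.
move=> aP bP; rewrite /refl_inv mulmxN mulmxA reflK ?root_neq0 // mul1mx.
by rewrite !pos_opp ?ref_mem // negbK andbC.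
Qed.

Lemma sum_refl_inv_opp (F : 'cV[R]_n -> R) a : a \in Psi ->
  \sum_(b <- undup Psi | refl_inv a b) F (- (refl a *m b))
  = \sum_(b <- undup Psi | refl_inv a b) F b.
Proof.
move=> aP; rewrite -(@sum_roots_reindex (fun b => - (refl a *m b)) (refl_inv a) F).
- rewrite [LHS]big_seq_cond [RHS]big_seq_cond; apply: eq_bigl => b.
  by rewrite mem_undup; case bP: (b \in Psi) => //=; rewrite refl_inv_opp.
- by move=> b bP; rewrite root_opp ?ref_mem.
- move=> x y _ _ /oppr_inj; apply: isometry_inj.
  exact/isometry_refl/root_neq0.
Qed.

(** Averaging the summand over the involution keeps the total and, when w a > 0, makes each term
    nonnegative. *)
Lemma sum_sgn_sym w a : a \in Psi ->
  \sum_(b <- undup Psi | refl_inv a b) (sgn (w *m b) + sgn (w *m - (refl a *m b))) / 2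
  = \sum_(b <- undup Psi | refl_inv a b) sgn (w *m b).
Proof.
move=> aP; rewrite -mulr_suml big_split /=.
by rewrite (sum_refl_inv_opp (fun b => sgn (w *m b))) //; lra.
Qed.

Lemma posb_partner w a b : a \in Psi -> b \in Psi -> posb a -> refl_inv a b ->
  posb (w *m b) -> posb (w *m - (refl a *m b)) -> posb (w *m a).
Proof.
move=> aP bP apos ab p1 p2.
have c1 := refl_inv_pair_ge1 aP bP apos ab.
have c0 : 0 < coroot_pair b a by apply: lt_le_trans c1.
suff -> : w *m a = (coroot_pair b a)^-1 *: (w *m b + w *m - (refl a *m b)).
  by rewrite posZ ?posD // invr_ge0 ltW.
rewrite -mulmxDr reflE -coroot_pairE opprB addrC subrK -scalemxAr scalerA.
by rewrite mulVf ?scale1r // lt0r_neq0.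
Qed.

Lemma negb_partner w a b : in_W Psi w -> a \in Psi -> b \in Psi -> posb a ->
  refl_inv a b ->
  posb (w *m a) -> ~~ posb (w *m b) -> posb (w *m - (refl a *m b)).
Proof.
move=> wW aP bP apos ab p1 p2; apply/negPn/negP => p3; move: p1.
apply/negP; rewrite -pos_opp ?in_W_root // -mulNmx.
have bP' : - (refl a *m b) \in Psi by rewrite root_opp ?ref_mem.
(* [posb_partner] holds for any matrix, so it applies to [- w]: two negative images would make w a
   negative. *)
by apply: (posb_partner _ _ apos ab) => //; rewrite mulNmx pos_opp ?in_W_root.
Qed.

Lemma sgn_partner_ge0 w a b : in_W Psi w -> a \in Psi -> b \in Psi -> posb a ->
  refl_inv a b -> posb (w *m a) ->
  0 <= (sgn (w *m b) + sgn (w *m - (refl a *m b))) / 2.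
Proof.
move=> wW aP bP apos ab wa; rewrite /sgn.
have := negb_partner wW aP bP apos ab wa.
case: posb => /= [_|/(_ isT) ->]; last by lra.
by case: posb; lra.
Qed.

Lemma refl_inv_self a : a \in Psi -> posb a -> refl_inv a a.
Proof. by move=> aP apos; rewrite /refl_inv refl_self ?root_neq0 // pos_opp // apos. Qed.

(** * Length as number of inversions *)

Lemma simple_word_in_W s : {subset s <= D} -> in_W Psi (wprod s).
Proof. by move=> sD; exists s; split=> // x /sD; apply: D_sub. Qed.

Lemma subset_rcons s d : {subset rcons s d <= D} -> d \in D /\ {subset s <= D}.
Proof.
move=> sD; split=> [|x xs]; apply: sD; rewrite mem_rcons inE ?eqxx //.
by rewrite xs orbT.
Qed.

Lemma rcons_subset s d : d \in D -> {subset s <= D} -> {subset rcons s d <= D}.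
Proof. by move=> dD sD x; rewrite mem_rcons inE => /predU1P[->|/sD]. Qed.

(** Induction on a bound m for the height of b. Some simple d has <b, d> > 0; unless b = d, the root
    s_d b is positive of smaller height, and s_b = s_d s_(s_d b) s_d. *)
Lemma refl_simple_word m b (k : 'I_(size D) -> int) : b \in Psi ->
    b = \sum_i (k i)%:~R *: nth 0 D i -> (forall i, 0 <= k i) ->
    \sum_i k i <= m%:Z ->
  exists s, {subset s <= D} /\ refl b = wprod s.
Proof.
elim: m b k => [|m IH] b k bP bE k0 km;
  have : 0 < dot b b by exact/dot_gt0/root_neq0.
- rewrite [X in dot _ X]bE dot_sumr big1 ?ltxx // => i _.
  have sum0 : \sum_i k i = 0 by apply/eqP; rewrite eq_le km sumr_ge0.
  by rewrite (psumr_eq0P (fun j _ => k0 j) sum0) // mulr0z scale0r dotC dot0l.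
rewrite [X in dot _ X]bE dot_sumr => sum0.
(* <b, b> > 0 is the sum of the terms k_i <b, d_i>, so one of these is positive. *)
have [i] : exists i, 0 < dot b ((k i)%:~R *: nth 0 D i).
  apply/existsP; apply: contraLR sum0 => /existsPn nex; rewrite -leNgt.
  by apply: sumr_le0 => i _; rewrite leNgt nex.
set d := nth 0 D i => bd.
have dD : d \in D by apply: mem_nth.
have dP := D_sub dD.
have [<-|ndb] := eqVneq d b.
  by exists [:: d]; rewrite /= mulmx1; split=> // x; rewrite inE => /eqP->.
have bpos : posb b.
  by apply/posbP; exists (fun i => (k i)%:~R); split=> // j; rewrite ler0z.
have sP := ref_mem dP bP.
have spos := simple_refl_pos dD bP bpos (_ : b != d).
rewrite eq_sym in spos; have {}spos := spos ndb.
have [l [lE l0]] := pos_int_coord sP spos.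
have [z zE] : exists z : int, coroot_pair b d = z%:~R.
  by rewrite coroot_pairE; case: rsPsi => _ _ H _; apply: H.
have z1 : 1 <= z.
  rewrite -gtz0_ge1 -(ltr0z R) -zE coroot_pairE.
  rewrite divr_gt0 ?dot_gt0 ?root_neq0 // mulr_gt0 //.
  move: bd; rewrite dotZr; apply: contraTT; rewrite -!leNgt.
  by apply: mulr_ge0_le0; rewrite ler0z.
have lk j : l j = k j - z * (j == i)%:R.
  apply: (@intr_inj R); rewrite rmorphB rmorphM /= natz.
  move: j; apply: base_inj; rewrite -lE reflE -coroot_pairE zE {1}bE -scaleNr.
  by rewrite addZ_nthE; apply: eq_bigr => j _; rewrite mulNr.
have [|s [sD sE]] := IH _ l sP lE l0.
  have -> : \sum_i l i = \sum_i k i - z.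
    rewrite (eq_bigr _ (fun j _ => lk j)) sumrB; congr (_ - _).
    rewrite -mulr_sumr (bigD1 i) //= eqxx big1 ?addr0 ?mulr1 // => j.
    by move=> /negPf->.
  by rewrite lerBlDr (le_trans km) // -addn1 PoszD lerD.
have dd := reflK (root_neq0 dP).
exists (d :: rcons s d); split.
  by move=> x; rewrite inE => /predU1P[->|/(rcons_subset dD sD)].
rewrite /= wprod_rcons -sE.
have := isometry_reflC b (isometry_refl (root_neq0 dP)) => E.
by rewrite -E !mulmxA dd mul1mx.
Qed.

Lemma in_W_simple_word w : in_W Psi w -> exists s, {subset s <= D} /\ w = wprod s.
Proof.
case=> s [sP ->]; elim: s sP => [|b s IH] sP /=; first by exists [::].
have bP : b \in Psi by apply/sP/mem_head.
have [|t [tD ->]] := IH; first by move=> x xs; apply: sP; rewrite inE xs orbT.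
(* b and -b define the same reflection, so the positive one may be used. *)
have [c [cP cpos ->]] : exists c, [/\ c \in Psi, posb c & refl b = refl c].
  case bpos: (posb b); first by exists b.
  by exists (- b); rewrite root_opp ?pos_opp ?bpos ?reflN.
have [k [kE k0]] := pos_int_coord cP cpos.
have [] := @refl_simple_word `|\sum_i k i| _ _ cP kE k0.
  by rewrite abszE ler_norm.
move=> r [rD ->]; exists (r ++ t); rewrite wprod_cat; split=> // x.
by rewrite mem_cat => /orP[/rD|/tD].
Qed.

(** Letters act from the right, and the first letter a that makes the image of d negative must equal
    the current image. Then s_d, moved left past the suffix, becomes s_a and cancels this letter. *)
Lemma exchange s d : {subset s <= D} -> d \in D -> ~~ posb (wprod s *m d) ->
  exists t, [/\ {subset t <= D}, (size t).+1 = size s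
    & wprod s *m refl d = wprod t].
Proof.
move=> + dD; elim: s => [|a s IH] sD /=; first by rewrite mul1mx pos_base.
have aD : a \in D by apply/sD/mem_head.
have sD' : {subset s <= D} by move=> x xs; apply: sD; rewrite inE xs orbT.
have sW := simple_word_in_W sD'.
rewrite -!mulmxA; case gpos: (posb (wprod s *m d)); last first.
  have [t [tD ts ->] _] := IH sD' (negbT gpos); exists (a :: t).
  rewrite /= ts; split=> // x.
  by rewrite inE => /predU1P[->|/tD].
have gP := in_W_root sW (D_sub dD).
have [gE _|ga] := eqVneq (wprod s *m d) a; last first.
  by rewrite simple_refl_pos.
exists s; split=> //.
rewrite isometry_reflC ?gE; last exact: in_W_isometry.
by rewrite mulmxA reflK ?mul1mx // root_neq0 // D_sub.
Qed.

Lemma inv1 : inv 1%:M = 0%N.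
Proof.
by rewrite /inv (eq_count (a2 := pred0)) ?count_pred0 // => b; rewrite mul1mx /= andbN.
Qed.

Lemma inv_word_le s : {subset s <= D} -> (inv (wprod s) <= size s)%N.
Proof.
elim/last_ind: s => [|s d IH] sD; first by rewrite /= inv1.
have [dD {}sD] := subset_rcons sD.
rewrite wprod_rcons size_rcons -(ler_nat R) inv_mul_simple //; last first.
  exact: simple_word_in_W.
rewrite -natr1 lerD ?ler_nat ?IH // /sgn.
by case: posb => //; lra.
Qed.

(** Built letter by letter: a letter that adds an inversion is appended, and one that removes an
    inversion shortens the word by [exchange]. *)
Lemma reduced_word s : {subset s <= D} ->
  exists t, [/\ {subset t <= D}, size t = inv (wprod s) & wprod s = wprod t].
Proof.
elim/last_ind: s => [|s d IH] sD; first by exists [::]; rewrite /= inv1.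
have [dD {}sD] := subset_rcons sD.
have [t [tD ts tE]] := IH sD; rewrite wprod_rcons.
have sW := simple_word_in_W sD.
have := inv_mul_simple sW dD; rewrite /sgn; case: ifPn => [_|neg] E.
  exists (rcons t d); rewrite size_rcons wprod_rcons ts -tE; split=> //.
    exact: rcons_subset.
  by apply/eqP; rewrite -(eqr_nat R) E natr1.
rewrite tE in neg; have [r [rD rs rE]] := exchange tD dD neg.
exists r; rewrite -rE tE; split=> //.
by apply/eqP; rewrite -(eqr_nat R) -tE E -ts -rs -natr1 addrK.
Qed.

Lemma has_wordP k w :
  reflect (exists s, [/\ {subset s <= D}, size s = k & w = wprod s]) (has_word D k w).
Proof.
apply: (iffP existsP) => [[t /eqP->]|[s [sD <- ->]]].
  exists [seq nth 0 D (nat_of_ord i) | i <- (t : seq _)].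
  rewrite size_map size_tuple; split=> // x /mapP[i _ ->].
  by rewrite mem_nth.
have [t ->] : exists t : seq 'I_(size D), s = [seq nth 0 D (nat_of_ord i) | i <- t].
  elim: s sD => [|d s IH] sD; first by exists [::].
  have [i iE] := base_nthE (sD d (mem_head _ _)).
  have [|t tE] := IH; first by move=> x xs; apply: sD; rewrite inE xs orbT.
  by exists (i :: t); rewrite /= -iE -tE.
by rewrite size_map; exists (in_tuple t).
Qed.

(** Each simple letter adds at most one inversion, so no word is shorter than [inv w], and a reduced
    word attains it. Since a word exists, the default value 0 of [ell] does not occur. *)
Lemma ell_inv w : in_W Psi w -> ell D w = inv w.
Proof.
move=> /in_W_simple_word[s [sD ->]].
have [t [tD ts tE]] := reduced_word sD.
have wt : has_word D (inv (wprod s)) (wprod s).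
  by apply/has_wordP; exists t.
rewrite /ell; case: excluded_middle_informative => [h|[]]; last first.
  by exists (inv (wprod s)).
case: ex_minnP => m /has_wordP[r [rD rs rE]] min.
by apply/eqP; rewrite eqn_leq min //= rE -rs inv_word_le.
Qed.

(** * Change of length under a reflection *)

Lemma ell_mul_refl w a : in_W Psi w -> a \in Psi ->
  (ell D (w *m refl a))%:R =
  (ell D w)%:R + \sum_(b <- undup Psi | refl_inv a b) sgn (w *m b).
Proof.
move=> wW aP; rewrite !ell_inv ?inv_mul_refl //.
by apply: in_WM => //; apply: in_W_refl.
Qed.

Lemma sgn_partner_self w a : a \in Psi -> posb (w *m a) ->
  (sgn (w *m a) + sgn (w *m - (refl a *m a))) / 2 = 1.
Proof.
move=> aP wa; rewrite refl_self ?root_neq0 // opprK /sgn wa; lra.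
Qed.

Lemma le_term_sum (F : 'cV[R]_n -> R) a : a \in Psi -> posb a ->
    {in Psi, forall b, refl_inv a b -> 0 <= F b} ->
  F a <= \sum_(b <- undup Psi | refl_inv a b) F b.
Proof.
move=> aP apos F0.
have <- : \sum_(b <- [:: a] | refl_inv a b) F b = F a.
  by rewrite big_mkcond big_seq1 refl_inv_self.
apply: ler_sum_sub; rewrite ?undup_uniq // => b; rewrite mem_undup; last exact: F0.
by rewrite inE => /eqP-> ->; rewrite aP.
Qed.

(** The symmetrised sum has nonnegative terms, and a, being its own partner, contributes 1. *)
Lemma ell_lt_mul_refl w a : in_W Psi w -> a \in Psi -> posb a ->
  posb (w *m a) -> (ell D w < ell D (w *m refl a))%N.
Proof.
move=> wW aP apos wa; rewrite -(ltr_nat R) ell_mul_refl // ltrDl -sum_sgn_sym //.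
apply: lt_le_trans ltr01 _; rewrite -[leLHS](sgn_partner_self aP wa).
apply: (le_term_sum (F := fun b => (sgn (w *m b) + sgn (w *m - (refl a *m b))) / 2)) => //.
by move=> b bP ab; apply: sgn_partner_ge0.
Qed.

Lemma ell_gt_mul_refl w a : in_W Psi w -> a \in Psi -> posb a ->
  ~~ posb (w *m a) -> (ell D (w *m refl a) < ell D w)%N.
Proof.
move=> wW aP apos wa.
(* The previous lemma applies to w s_a, which sends a to - w a > 0. *)
rewrite -{2}[w]mulmx1 -(reflK (root_neq0 aP)) mulmxA.
apply: ell_lt_mul_refl => //; first by apply: in_WM => //; apply: in_W_refl.
by rewrite -mulmxA refl_self ?root_neq0 // mulmxN pos_opp // in_W_root.
Qed.

End BasedRootSystem.

(** * Restriction of an edge to the subsystem *)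

Theorem theorem5p3 (R : realFieldType) (n : nat)
    (Phi D : seq 'cV[R]_n) (Phib Db : seq 'cV[R]_n)
    (w u wb : 'M[R]_n) (a : 'cV[R]_n) :
  (* Phi: irreducible root system in R^n with base D (positive roots Phi^+) *)
  is_root_system Phi -> spans Phi -> irreducible Phi -> is_base Phi D ->
  (* Phib: rank 2 root subsystem, with base Db whose positive roots are
     Phib^+ = Phib \cap Phi^+ *)
  {subset Phib <= Phi} -> is_root_system Phib -> rank_rs Phib = 2%N ->
  is_base Phib Db ->
  (forall b, b \in Phib -> (pos Db b <-> pos D b)) ->
  (* w in W, w = floor(w) * wb with wb in Wbar, floor(w) minimal in w Wbar *)
  in_W Phi w ->
  coset_minimal Phib D w u ->
  in_W Phib wb -> w = u *m wb ->
  (* an edge w --a--> w s_a of QB(W) with a in Phib^+ *)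
  QB_edge Phi D w a -> a \in Phib ->
  QB_edge Phib Db wb a.
Proof.
move=> rs _ _ bs sub rsb _ bsb posE wW [[x [xW uE]] umin] wbW wE
  [_ aP /posbP apos edge] aPb.
have posbE b : b \in Phib -> posb Db b = posb D b.
  by move=> bP; apply/posbP/posbP => /(posE _ bP).
have subW v : in_W Phib v -> in_W Phi v.
  by case=> s [sP ->]; exists s; split=> // c /sP /sub.
have uW : in_W Phi u by rewrite uE; apply: in_WM => //; apply: subW.
(* If u b were negative for a positive b of the subsystem, u s_b would lie below u in the coset. *)
have upos b : b \in Phib -> posb D b -> posb D (u *m b).
  move=> bPb bpos; apply/negPn/negP => ub; apply: umin.
  have uC : in_coset Phib w (u *m refl b).
    exists (x *m refl b); rewrite uE mulmxA; split=> //.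
    by apply: in_WM => //; apply: in_W_refl.
  exists (u *m refl b); split=> //; apply: t_step; split=> //.
  exists b; rewrite -mulmxA reflK ?mulmx1 ?(root_neq0 rsb) //; split=> //.
  split=> //; exact: (ell_gt_mul_refl rs bs uW (sub _ bPb) bpos ub).
have usgn b : b \in Phib -> sgn Db (wb *m b) = sgn D (w *m b).
  move=> bPb; have cPb := in_W_root rsb wbW bPb.
  rewrite wE -mulmxA; move: (wb *m b) cPb => c cPb.
  rewrite /sgn posbE //; have [cpos|cneg] := ifPn; first by rewrite upos.
  have cN : posb D (- c) by rewrite (pos_opp rs bs) // sub.
  have := upos _ (root_opp rsb cPb) cN.
  rewrite mulmxN (pos_opp rs bs) => [/negPf->//|].
  exact: (in_W_root rs uW (sub _ cPb)).
have ninvE b : b \in Phib -> refl_inv Db a b = refl_inv D a b.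
  move=> bPb; rewrite /refl_inv !posbE //.
  by case: rsb => _ H _ _; apply: H.
have aposb : posb Db a by rewrite posbE.
have sub_le (F : 'cV[R]_n -> R) : {in Phi, forall b, refl_inv D a b -> 0 <= F b} ->
  \sum_(b <- undup Phib | refl_inv Db a b) F b
  <= \sum_(b <- undup Phi | refl_inv D a b) F b.
  move=> F0; apply: ler_sum_sub; rewrite ?undup_uniq // => b; rewrite !mem_undup.
    by move=> bPb; rewrite ninvE // sub.
  exact: F0.
(* Squeeze: 1 <= F a <= sum over the subsystem <= full sum = 1. *)
have sub_eq1 (F : 'cV[R]_n -> R) : {in Phi, forall b, refl_inv D a b -> 0 <= F b} -> 1 <= F a ->
    \sum_(b <- undup Phi | refl_inv D a b) F b = 1 ->
    \sum_(b <- undup Phib | refl_inv Db a b) F b = 1.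
  move=> F0 Fa F1; apply: le_anti; rewrite -{1}F1 sub_le //=.
  apply: (le_trans Fa); apply: (le_term_sum rsb bsb aPb aposb) => b bPb.
  by rewrite ninvE //; apply: F0; apply: sub.
have sgn_sub : \sum_(b <- undup Phib | refl_inv Db a b) sgn Db (wb *m b)
    = \sum_(b <- undup Phib | refl_inv Db a b) sgn D (w *m b).
  rewrite big_seq_cond [RHS]big_seq_cond; apply: eq_bigr => b.
  by rewrite mem_undup => /andP[/usgn].
have ellW := ell_mul_refl rs bs wW aP.
have ellWb := ell_mul_refl rsb bsb wbW aPb.
split=> //; first exact/posbP.
case: edge => [up|[h [hP down]]]; [left|right].
  move: ellW; rewrite up -natr1 => /addrI S1.
  (* A negative w a would make the length drop, but here it rises by 1. *)
  have wa : posb D (w *m a).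
    apply/negPn/negP => /(ell_gt_mul_refl rs bs wW aP apos).
    by rewrite up ltnNge leqnSn.
  apply/eqP; rewrite -(eqr_nat R) ellWb -natr1 (inj_eq (addrI _)).
  rewrite -(sum_sgn_sym rsb bsb _ aPb); apply/eqP.
  (* Each term is nonnegative since w a > 0, the term at a is 1, and the total is the length
     difference 1. *)
  pose F b := (sgn D (w *m b) + sgn D (w *m - (refl a *m b))) / 2.
  rewrite -[RHS](@sub_eq1 F).
  - rewrite big_seq_cond [RHS]big_seq_cond; apply: eq_bigr => b.
    rewrite mem_undup => /andP[bPb _]; rewrite /F !usgn //.
    by apply: (root_opp rsb); case: rsb => _ H _ _; apply: H.
  - by move=> b bP ab; apply: (sgn_partner_ge0 rs bs).
  - by rewrite /F (sgn_partner_self rs).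
  - by rewrite (sum_sgn_sym rs bs).
have [hb hbP] := coroot_ht_ex rsb bsb aPb; exists hb; split=> //.
(* F >= 0 as the pairing is at least 1 and the sign at least -1; F a = 2 + sgn(w a) >= 1; the total
   is 2 h + (1 - 2 h) = 1. *)
pose F b := coroot_pair b a + sgn D (w *m b).
have F1 : \sum_(b <- undup Phib | refl_inv Db a b) F b = 1.
  apply: sub_eq1 => [b bP ab||].
  - have := refl_inv_pair_ge1 rs aP bP apos ab.
    by rewrite /F /sgn; case: ifP => _; lra.
  - rewrite /F coroot_pairE mulfK ?(lt0r_neq0 (dot_gt0 (root_neq0 rs aP))) //.
    by rewrite /sgn; case: ifP => _; lra.
  - by rewrite big_split /= (sum_pair_height rs bs aP hP); lra.
(* In the subsystem the pairings sum to 2 [hb], so the signs sum to 1 - 2 [hb], which is the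
   required length difference. *)
move: F1; rewrite big_split /= (sum_pair_height rsb bsb aPb hbP) -sgn_sub; lra.
Qed.
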